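(* Let $M$ be a countable structure, let $G \leq \mathrm{Sym}(M)$ be a Polish group, and let $n \geq 1$. The following are equivalent: (1) $\mathcal{K}_{G,n}$ satisfies the joint embedding property (JEP); (2) there are $\Phi_1, \ldots, \Phi_n \in G$ such that $(\Phi_1, \ldots, \Phi_n)$ is $\mathcal{K}_{G,n}$-universal; (3) $G$ has a dense $n$-diagonal conjugacy class.
   Context: $M$ is a countable first-order structure and $G\le \mathrm{Sym}(M)$ is a group of permutations of $M$ which is Polish in the topology of pointwise convergence. A map $S:A\to B$ between substructures of $M$ is $G$-extendable if some $g\in G$ extends it. For a map $f$, $\mathrm{zdef}(f)=\mathrm{dom}(f)\cup\mathrm{rng}(f)$. $\mathcal{K}_{G,n}$ is the family of all $n$-tuples $\bar S=(S_1,\dots,S_n)$ where each $S_i$ is a $G$-extendable bijection between finitely generated substructures of $M$. For $n$-tuples $\bar S,\bar T$ of partial maps on $M$, an embedding of $\bar S$ into $\bar T$ is a $G$-extendable injection $\phi$ whose domain is a substructure of $M$ containing $\bigcup_i\mathrm{zdef}(S_i)$, such that $\phi(S_i(x))=T_i(\phi(x))$ for all $i$ and all $x\in\mathrm{dom}(S_i)$. JEP: for all $\bar S,\bar T\in\mathcal{K}_{G,n}$ there are $\bar U\in\mathcal{K}_{G,n}$ and embeddings of $\bar S$ and of $\bar T$ into $\bar U$. A tuple $(\Phi_1,\dots,\Phi_n)\in G^n$ is $\mathcal{K}_{G,n}$-universal if every element of $\mathcal{K}_{G,n}$ embeds into it. An $n$-diagonal conjugacy class in $G$ is a set $\{(g^{-1}g_1g,\dots,g^{-1}g_ng):g\in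 G\}\subseteq G^n$ for some $(g_1,\dots,g_n)\in G^n$; density refers to the product topology on $G^n$.
   Formalization: Added hypothesis: every element of G commutes with the functions and constants of M (automatic if M is relational or G ≤ Aut(M)). Without it the claim fails: M = (N, 0, succ), G = Sym(N), n = 1 satisfies (3) but not (1) or (2). *)

(* Defs.v *)
From HB Require Import structures.
From mathcomp Require Import all_boot all_order all_algebra.
From mathcomp Require Import all_classical all_reals all_analysis.

Set Implicit Arguments.
Unset Strict Implicit.
Unset Printing Implicit Defensive.

Import Order.TTheory GRing.Theory Num.Theory.
Import numFieldNormedType.Exports.

Local Open Scope classical_set_scope.
Local Open Scope ring_scope.

Section FirstOrder.

(* Constants are function symbols of arity 0. *)
Record signature := Signature {
  fsymb : Type;
  farity : fsymb -> nat;
  rsymb : Type;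
  rarity : rsymb -> nat }.

Record structure (L : signature) (M : Type) := Structure {
  finterp : forall f : fsymb L, (farity f).-tuple M -> M;
  rinterp : forall r : rsymb L, (rarity r).-tuple M -> Prop }.

Variables (L : signature) (M : Type) (str : structure L M).

(* Substructures are induced, so they are determined by their universe.  The
   empty set is one when the signature has no constants. *)
Definition substructure (A : set M) : Prop :=
  forall (f : fsymb L) (v : (farity f).-tuple M),
    (forall i, A (tnth v i)) -> A (finterp str v).

Definition finitely_generated (A : set M) : Prop :=
  exists2 F : set M, finite_set F & A = smallest substructure F.

(* Vacuous for relational signatures, and implied by being an automorphism;
   relations need not be preserved.  Under this condition, the image of a
   finitely generated substructure is one, and its restriction to such a
   substructure is determined by the values at finitely many generators. *)
Definition respects_operations (g : M -> M) : Prop :=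
  forall (f : fsymb L) (v : (farity f).-tuple M),
    g (finterp str v) = finterp str (map_tuple g v).

End FirstOrder.

Section Polish.
Variables (R : realType) (T : topologicalType).

Definition separable : Prop := exists2 D : set T, countable D & dense D.

Definition is_metric (d : T -> T -> R) : Prop :=
  [/\ forall x y, 0 <= d x y,
      forall x y, d x y = 0 <-> x = y,
      forall x y, d x y = d y x &
      forall x y z, d x z <= d x y + d y z].

Definition metrizes (d : T -> T -> R) : Prop :=
  forall (x : T) (A : set T),
    nbhs x A <-> exists2 e : R, 0 < e & [set y | d x y < e] `<=` A.

Definition complete_metric (d : T -> T -> R) : Prop :=
  forall u : nat -> T,
    (forall e : R, 0 < e -> exists N : nat,
       forall m k : nat, (N <= m)%N -> (N <= k)%N -> d (u m) (u k) < e) ->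
    exists l : T, u @ \oo --> l.

Definition polish : Prop :=
  separable /\
  exists d : T -> T -> R, [/\ is_metric d, metrizes d & complete_metric d].

End Polish.

(* Self-maps of the discrete set M, with the topology of pointwise
   convergence; a set G of them, seen as a type, has the subspace topology. *)
Notation selfmap M := {ptws M -> discrete_topology M}.

Definition permutation_group (M : countType) (G : set (selfmap M)) : Prop :=
  [/\ forall g, G g -> bijective g,
      G id,
      forall g h, G g -> G h -> G (g \o h) &
      forall g, G g -> exists2 h, G h & cancel g h /\ cancel h g].

Section PartialMaps.
Variables (M : countType).

Definition partial_map : Type := M -> option M.

Definition dom (f : partial_map) : set M := [set x | f x <> None].
Definition rng (f : partial_map) : set M := [set y | exists x, f x = Some y].
Definition zdef (f : partial_map) : set M := dom f `|` rng f.

Definition injective_pmap (f : partial_map) : Prop :=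
  forall x y z, f x = Some z -> f y = Some z -> x = y.

Definition extendable (G : set (selfmap M)) (f : partial_map) : Prop :=
  exists2 g : selfmap M, G g & forall x y, f x = Some y -> g x = y.

Definition total_map (g : selfmap M) : partial_map := fun x => Some (g x).

End PartialMaps.

Section JointEmbedding.
Variables (L : signature) (M : countType) (str : structure L M).
Variables (G : set (selfmap M)) (n : nat).

Definition KGn (S : 'I_n -> partial_map M) : Prop :=
  forall i, [/\ finitely_generated str (dom (S i)),
                finitely_generated str (rng (S i)),
                injective_pmap (S i) &
                extendable G (S i)].

(* Since zdef (S i) is contained in dom phi, the left-hand side of the last
   equation is defined; the equation thus also says that phi x is in the
   domain of T i. *)
Definition embedding (phi : partial_map M) (S T : 'I_n -> partial_map M) :
    Prop :=
  [/\ injective_pmap phi,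
      extendable G phi,
      substructure str (dom phi),
      \bigcup_i zdef (S i) `<=` dom phi &
      forall i x, dom (S i) x -> obind phi (S i x) = obind (T i) (phi x)].

Definition embeds (S T : 'I_n -> partial_map M) : Prop :=
  exists phi, embedding phi S T.

Definition JEP : Prop :=
  forall S T, KGn S -> KGn T -> exists U, [/\ KGn U, embeds S U & embeds T U].

Definition universal (Phi : 'I_n -> set_type G) : Prop :=
  forall S, KGn S -> embeds S (fun i => total_map (set_val (Phi i))).

End JointEmbedding.

(* The second element h is the inverse of g.  G^n carries the product
   topology, which is what the ptws notation denotes. *)
Definition diagonal_class (M : countType) (G : set (selfmap M)) (n : nat)
    (a : 'I_n -> set_type G) : set {ptws 'I_n -> set_type G} :=
  [set b | exists g h : selfmap M,
     [/\ G g, G h, cancel g h /\ cancel h g &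
         forall i, set_val (b i) = h \o set_val (a i) \o g]].

Definition has_dense_diagonal_class (M : countType) (G : set (selfmap M))
    (n : nat) : Prop :=
  exists a : 'I_n -> set_type G, dense (diagonal_class a).

(* Main.v *)
(* Both universality of Phi and density of its diagonal conjugacy class say that
   for every tuple h in G^n and every finite set F some conjugate of Phi agrees
   with h on F; an element of K_{G,n} enters only through an extension h of it
   and a finite set F generating its domains.  A universal tuple, restricted to
   finitely generated substructures, witnesses the JEP.  Conversely, for fixed
   F and h the tuples having a conjugate that agrees with h on F form an open
   set, the JEP makes it dense, and there are countably many such sets, so they
   have a common point by the Baire category theorem in the Polish space G^n. *)

Require Import Defs.
From mathcomp Require Import all_boot all_order all_algebra.
From mathcomp Require Import all_classical all_reals all_analysis.

Set Implicit Arguments.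
Unset Strict Implicit.
Unset Printing Implicit Defensive.

Import Order.TTheory GRing.Theory Num.Theory.

Local Open Scope classical_set_scope.
Local Open Scope ring_scope.

(** * Basic neighbourhoods in a product topology *)

Section ProductTopology.
Variables (I : choiceType) (T : topologicalType).
Implicit Types f : {ptws I -> T}.

Lemma nbhs_ptwsP f (A : set {ptws I -> T}) :
  nbhs f A <-> exists s : seq I, exists2 V : I -> set T,
    forall i, nbhs (f i) (V i) &
    [set g | forall i, i \in s -> V i (g i)] `<=` A.
Proof.
have FF := nbhs_filter f; split; last first.
  move=> [s [V fV sVA]]; apply: filterS sVA _ => /=.
  elim: s => [|i s IHs].
    by apply: filterS filterT => g _ i; rewrite in_nil.
  have fVi : nbhs f (proj i @^-1` V i).
    exact: (@proj_continuous _ (fun=> T) i f _ (fV i)).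
  apply: filterS (filterI fVi IHs) => g [Vig Vg] j.
  by rewrite inE => /predU1P[->//|]; exact: Vg.
(* [F] is the filter generated by the boxes that constrain finitely many coordinates. Convergence
   [F --> f] says exactly that every neighbourhood of [f] contains such a box. *)
pose F := filter_from
  [set sV : seq I * (I -> set T) | forall i, nbhs (f i) (sV.2 i)]
  (fun sV => [set g : {ptws I -> T} | forall i, i \in sV.1 -> sV.2 i (g i)]).
have {}FF : Filter F.
  apply: filter_from_filter; first by
    exists ([::], fun=> setT) => i; exact: filterT.
  move=> [s V] [s' V'] /= fV fV'.
  exists (s ++ s', fun i => V i `&` V' i) => /=; first by move=> i; exact: filterI.
  by move=> g gV; split=> i si; have [] := gV i; rewrite // mem_cat si ?orbT.
suff : F --> f by move=> /[apply] -[[s V] /= fV sVA]; exists s, V.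
(* The product topology is the supremum of the topologies induced by the projections, so one
   coordinate [i] at a time suffices. *)
apply/cvg_sup => i B [_ [[U oU <-] Uf] UB].
exists ([:: i], fun j => if j == i then U else setT) => /=.
  move=> j; case: eqP => [->|_]; last exact: filterT.
  exact: open_nbhs_nbhs.
by move=> g /(_ i); rewrite eqxx mem_head => /(_ isT) Ug; exact: UB.
Qed.

End ProductTopology.

(** * The Baire category theorem in a finite power of a Polish space *)

Section Baire.
Variables (R : realType) (T : topologicalType) (I : finType).

Lemma nbhs_ptws_metricP (d : T -> T -> R) (b : {ptws I -> T})
    (A : set {ptws I -> T}) : metrizes d ->
  nbhs b A <->
  exists2 e : R, 0 < e & [set c | forall i, d (b i) (c i) < e] `<=` A.
Proof.
move=> dT; split=> [/nbhs_ptwsP[s [V bV VA]]|[e e0 eA]].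
  have /choice[e eV] i : exists e : R,
      0 < e /\ [set y | d (b i) y < e] `<=` V i.
    by have [e] := (dT _ _).1 (bV i); exists e.
  (* The default 1 keeps the radius positive when [I] is empty. *)
  exists (\big[Num.min/1]_i e i).
    by apply/bigmin_gtP; split=> // i _; have [] := eV i.
  move=> c bc; apply: VA => i _; apply: (eV i).2 => /=.
  by apply: lt_le_trans (bc i) _; exact: bigmin_le_cond.
apply/nbhs_ptwsP; exists (enum I), (fun i => [set y | d (b i) y < e]).
  by move=> i; apply/dT; exists e.
by move=> c bc; apply: eA => i; apply: bc; rewrite mem_enum.
Qed.

(** Closed balls of the maximum metric are nested with radii tending to 0, each inside the next
    dense open set. Their centres are Cauchy in each coordinate, and the limit lies in all the
    balls. *)
Lemma polish_power_baire (C : countType) (O : C -> set {ptws I -> T}) :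
    polish R T -> [set: {ptws I -> T}] !=set0 ->
    (forall c, open (O c)) -> (forall c, dense (O c)) ->
  exists b, forall c, O c b.
Proof.
move=> [_ [d [[d_ge0 d_eq0 dC d_tri] dT d_complete]]] [b0 _] oO dO.
pose ball (be : {ptws I -> T} * {e : R | 0 < e}) :=
  [set c : {ptws I -> T} | forall i, d (be.1 i) (c i) < val be.2].
pose cball (be : {ptws I -> T} * {e : R | 0 < e}) :=
  [set c : {ptws I -> T} | forall i, d (be.1 i) (c i) <= val be.2].
pose rad (e : R) (e0 : 0 < e) : {e : R | 0 < e} := exist _ e e0.
have ball_open be c : ball be c -> nbhs c (ball be).
  move=> bc; apply/(nbhs_ptws_metricP _ _ dT).
  exists (\big[Num.min/1]_i (val be.2 - d (be.1 i) (c i))).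
    by apply/bigmin_gtP; split=> // i _; rewrite subr_gt0; exact: bc.
  move=> c' cc' i; apply: le_lt_trans (d_tri _ (c i) _) _.
  by rewrite -ltrBrDl; apply: lt_le_trans (cc' i) _; exact: bigmin_le_cond.
have step (kbe : nat * ({ptws I -> T} * {e : R | 0 < e})) :
    exists be' : {ptws I -> T} * {e : R | 0 < e},
    [/\ cball be' `<=` ball kbe.2, val be'.2 <= kbe.1.+1%:R^-1 &
        forall c, unpickle kbe.1 = Some c -> cball be' `<=` O c].
  case: kbe => k be.
  (* Stage [k] treats the index coded by [k]; a [k] that codes no index imposes no condition. *)
  pose Ok := if unpickle k is Some c then O c else setT.
  have oOk : open (ball be `&` Ok).
    apply: openI; first by rewrite openE => c; exact: ball_open.
    by rewrite /Ok; case: unpickle => [c|]; [exact: oO | exact: openT].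
  have [b' bb'] : ball be `&` Ok !=set0.
    have ball0 : ball be !=set0.
      by exists be.1 => i /=; rewrite (d_eq0 _ _).2 //; exact: (valP be.2).
    have oB : open (ball be) by rewrite openE => c; exact: ball_open.
    rewrite /Ok; case: unpickle => [c|]; first exact: dO.
    by rewrite setIT.
  have [e e0 eO] := (nbhs_ptws_metricP _ _ dT).1 (open_nbhs_nbhs (conj oOk bb')).
  (* The bound [e / 2] puts the closed ball inside the open ball of radius [e]; the other bound
     makes the radii tend to 0. *)
  have e'0 : 0 < Num.min (e / 2) k.+1%:R^-1 :> R.
    by rewrite lt_min divr_gt0 //= invr_gt0.
  have cO : cball (b', rad _ e'0) `<=` ball be `&` Ok.
    move=> c b'c; apply: eO => i /=; apply: le_lt_trans (b'c i) _ => /=.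
    by rewrite gt_min ltr_pdivrMr // ltr_pMr // ltr1n.
  exists (b', rad _ e'0); split=> /=.
  - by move=> c /cO[].
  - by rewrite ge_min lexx orbT.
  - by move=> c kc c' /cO[_]; rewrite /Ok kc.
have [nxt nxtP] := choice step.
pose u := fix u k := if k is k'.+1 then nxt (k', u k')
                     else (b0, rad 1 ltr01).
have cball_ball be : ball be `<=` cball be.
  by move=> c bc i; exact: ltW (bc i).
have nested m k : (m <= k)%N -> ball (u k) `<=` ball (u m).
  elim: k => [|k IHk]; first by rewrite leqn0 => /eqP->.
  rewrite leq_eqVlt => /predU1P[->//|/IHk ukm].
  by move=> c /cball_ball; have [+ _ _] := nxtP (k, u k) => /[apply]; exact: ukm.
have center k : ball (u k) (u k).1.
  by move=> i /=; rewrite (d_eq0 _ _).2 //; exact: (valP (u k).2).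
have radius (e : R) : 0 < e -> exists k, val (u k).2 < e.
  move=> e0; have [k _ /(_ k (leqnn k)) ke] := near_infty_natSinv_lt (PosNum e0).
  by exists k.+1; have [_ + _] := nxtP (k, u k) => /le_lt_trans; apply.
have /choice[l ul] i : exists l : T, (u k).1 i @[k --> \oo] --> l.
  apply: d_complete => e e0.
  have [N Ne] := radius (e / 2) (divr_gt0 e0 (ltr0Sn _ 1)).
  exists N => m k Nm Nk; rewrite [e]splitr.
  apply: le_lt_trans (d_tri _ ((u N).1 i) _) _.
  by rewrite dC ltrD //; apply: lt_trans Ne; apply: nested (center _) _.
exists l => c.
(* It suffices that [l] lies in the closed ball built at stage [pickle c], which is contained in
   [O c]. *)
have [_ _ /(_ c)] := nxtP (pickle c, u (pickle c)); apply; first exact: pickleK.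
rewrite -/(u (pickle c).+1) => i; apply/ler_addgt0Pl => e e0.
have [N _ Ne] : \forall k \near \oo, d (l i) ((u k).1 i) < e.
  by apply: (ul i [set y | d (l i) y < e]); apply/dT; exists e.
(* From [N] on the centres are [e]-close to [l i]; from [(pickle c).+1] on they lie in the ball in
   question. *)
set k := maxn N (pickle c).+1.
apply: le_trans (d_tri _ ((u k).1 i) _) _; rewrite addrC lerD //.
  by rewrite dC; apply/ltW/Ne; exact: leq_maxl.
exact/ltW/(nested _ _ (leq_maxr _ _) _ (center k)).
Qed.

End Baire.

(** * Generated substructures and maps respecting the operations *)

Section GeneratedSubstructures.
Variables (L : signature) (M : choiceType) (str : structure L M).
Implicit Types (g h : M -> M) (F : set M).

Lemma substructure_generated F :
  substructure str (smallest (substructure str) F).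
Proof.
move=> f v Fv A AF; have [sA FA] := AF; apply: sA => i.
exact: Fv.
Qed.

Lemma respects_operations_comp g h :
  respects_operations str g -> respects_operations str h ->
  respects_operations str (g \o h).
Proof.
by move=> gstr hstr f v /=; rewrite hstr gstr; congr finterp; apply: val_inj;
  rewrite /= map_comp.
Qed.

(** The points where [g] and [h] agree form a substructure. *)
Lemma eq_generated F g h :
  respects_operations str g -> respects_operations str h ->
  {in F, g =1 h} -> {in smallest (substructure str) F, g =1 h}.
Proof.
move=> gstr hstr gh x; rewrite inE => /(_ [set y | g y = h y]); apply.
split=> [f v ghv|y Fy] /=; last by apply: gh; rewrite inE.
rewrite gstr hstr; congr finterp; apply: eq_from_tnth => i.
by rewrite !tnth_map; exact: ghv.
Qed.

(** The preimage under [g] of a substructure is a substructure. *)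
Lemma sub_generated_image F g : respects_operations str g ->
  g @` smallest (substructure str) F `<=`
  smallest (substructure str) (g @` F).
Proof.
move=> gstr _ [x Fx <-] A [sA FA].
apply: (Fx (g @^-1` A)); split=> [f v Av|y Fy]; last by apply: FA; exists y.
by rewrite /preimage/= gstr; apply: sA => i; rewrite tnth_map; exact: Av.
Qed.

Lemma generated_image F g h : cancel g h -> cancel h g ->
  respects_operations str g -> respects_operations str h ->
  g @` smallest (substructure str) F = smallest (substructure str) (g @` F).
Proof.
move=> gK hK gstr hstr; apply/seteqP; split; first exact: sub_generated_image.
move=> y Fy; exists (h y) => //.
suff <- : h @` (g @` F) = F by apply: sub_generated_image => //; exists y.
by rewrite image_comp -[RHS]image_id; congr image; apply: funext => x /=.
Qed.

End GeneratedSubstructures.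

(** * Restrictions of total maps to subsets *)

Definition restrict_map (M : countType) (A : set M) (g : M -> M) :
    partial_map M :=
  fun x => if `[< A x >] then Some (g x) else None.

Lemma restrict_mapE (M : countType) (A : set M) (g : M -> M) x :
  A x -> restrict_map A g x = Some (g x).
Proof. by rewrite /restrict_map => /asboolT ->. Qed.

Lemma restrict_mapP (M : countType) (A : set M) (g : M -> M) x y :
  restrict_map A g x = Some y -> A x /\ g x = y.
Proof. by rewrite /restrict_map; case: asboolP => // Ax [<-]. Qed.

Lemma dom_restrict_map (M : countType) (A : set M) (g : M -> M) :
  dom (restrict_map A g) = A.
Proof.
apply/seteqP; split=> x; rewrite /dom/= /restrict_map; first by case: asboolP.
by move=> /asboolT ->.
Qed.

Lemma rng_restrict_map (M : countType) (A : set M) (g : M -> M) :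
  rng (restrict_map A g) = g @` A.
Proof.
apply/seteqP; split=> y /= [x].
  by move=> /restrict_mapP[Ax <-]; exists x.
by move=> Ax <-; exists x; exact: restrict_mapE.
Qed.

(** * Conjugates agreeing with a given tuple on a finite set *)

Section Group.
Variables (L : signature) (M : countType) (str : structure L M).
Variables (G : set (selfmap M)) (n : nat).
Hypothesis hG : permutation_group G.
Hypothesis hGstr : forall g, G g -> respects_operations str g.
Implicit Types (F : seq M) (h k Phi : 'I_n -> set_type G).

Let generated F := smallest (substructure str) [set` F].

Let Gval (p : set_type G) : G (set_val p).
Proof. exact: set_valP. Qed.

Let lift_group (h : 'I_n -> selfmap M) : (forall i, G (h i)) ->
  exists Phi, forall i, set_val (Phi i) = h i.
Proof.
by move=> Gh; exists (fun i => exist _ (h i) (mem_set (Gh i))).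
Qed.

Let group_inj g : G g -> injective g.
Proof. by case: hG => + _ _ _ => /[apply]/bij_inj. Qed.

(* Inverse-free form of: every [g^-1 Phi_i g] agrees with [h_i] on [F]. *)
Definition conj_agree F h Phi :=
  exists2 g : selfmap M, G g &
    forall i x, x \in F -> set_val (Phi i) (g x) = g (set_val (h i) x).

Lemma conj_agree_generated F h Phi (g : selfmap M) : G g ->
  (forall i x, x \in F -> set_val (Phi i) (g x) = g (set_val (h i) x)) ->
  forall i x, generated F x -> set_val (Phi i) (g x) = g (set_val (h i) x).
Proof.
move=> Gg gP i x Fx.
apply: (@eq_generated _ _ str [set` F] (set_val (Phi i) \o g)
                      (g \o set_val (h i))); last by rewrite inE.
- by apply: respects_operations_comp; apply: hGstr.
- by apply: respects_operations_comp; apply: hGstr.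
- by move=> y; rewrite inE; exact: gP.
Qed.

(** * Tuples in $K_{G,n}$ and their embeddings *)

Lemma KGn_restrict F h :
  KGn str G (fun i => restrict_map (generated F) (set_val (h i))).
Proof.
move=> i; have [_ _ _ /(_ _ (Gval (h i)))[h' Gh' [hK h'K]]] := hG.
split.
- by rewrite dom_restrict_map; exists [set` F] => //; exact: finite_seq.
- rewrite rng_restrict_map (generated_image _ hK h'K); try exact: hGstr.
  by exists (set_val (h i) @` [set` F]) => //; apply/finite_image/finite_seq.
- move=> x y z /restrict_mapP[_ <-] /restrict_mapP[_ e].
  exact/esym/(group_inj (Gval (h i))).
- by exists (set_val (h i)) => // x y /restrict_mapP[].
Qed.

Let generated_sub F F' : {subset F <= F'} -> generated F `<=` generated F'.
Proof.
move=> FF'; apply: smallest_sub; first exact: substructure_generated.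
by apply: sub_smallest => x; exact: FF'.
Qed.

Let generated_map F (g : selfmap M) x : G g ->
  generated F x -> generated (map g F) (g x).
Proof.
move=> Gg Fx; rewrite /generated (_ : [set` map g F] = g @` [set` F]).
  by apply: sub_generated_image; [exact: hGstr | exists x].
apply/seteqP; split=> y /=; first by move=> /mapP[z Fz ->]; exists z.
by move=> [z Fz <-]; exact: map_f.
Qed.

(** Concatenating generators of the [n] domains gives a single finite list that serves all
    coordinates. *)
Lemma KGn_extend S : KGn str G S ->
  exists F h, forall i x, dom (S i) x ->
    generated F x /\ S i x = Some (set_val (h i) x).
Proof.
move=> KS.
have /choice[Fh FhP] i : exists Fh : seq M * selfmap M, [/\ G Fh.2,
    dom (S i) = generated Fh.1 & forall x y, S i x = Some y -> Fh.2 x = y].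
  have [[A /finite_seqP[F ->] SF] _ _ [h Gh hS]] := KS i.
  by exists (F, h).
have [|h hP] := @lift_group (fun i => (Fh i).2).
  by move=> i; case: (FhP i).
exists (flatten [seq (Fh i).1 | i <- enum 'I_n]), h => i x Sx.
have [_ SE hS] := FhP i; split; last first.
  rewrite hP; move: Sx (hS x); rewrite /dom/=.
  by case: (S i x) => // y _ /(_ y erefl) ->.
move: Sx; rewrite SE; apply: generated_sub => y Fy.
by apply/flattenP; exists (Fh i).1 => //; apply: map_f; rewrite mem_enum.
Qed.

Lemma embeds_restrict F h T :
  embeds str G (fun i => restrict_map (generated F) (set_val (h i))) T ->
  exists2 g : selfmap M, G g &
    forall i x, x \in F -> T i (g x) = Some (g (set_val (h i) x)).
Proof.
move=> [phi [_ [g Gg gphi] _ zphi phiE]]; exists g => // i x Fx.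
have genx : generated F x by exact: (sub_smallest (X := [set` F])).
have domx : dom (restrict_map (generated F) (set_val (h i))) x.
  by rewrite dom_restrict_map.
have phi_g y : dom phi y -> phi y = Some (g y).
  by rewrite /dom/=; case E : (phi y) => [z|] // _; rewrite (gphi _ _ E).
have /= := phiE i x domx; rewrite restrict_mapE //= phi_g; last first.
  (* The point [set_val (h i) x] lies in the range of the restriction, so [phi] is defined there. *)
  apply: zphi; exists i => //; right; exists x; exact: restrict_mapE.
rewrite phi_g /=; first by move=> <-.
by apply: zphi; exists i => //; left.
Qed.

(** With all of [M] as domain, an element of [G] meets every condition on an embedding except the
    intertwining equation. *)
Lemma embeds_total_map (g : selfmap M) h (S T : 'I_n -> partial_map M) : G g ->
  (forall i x, dom (S i) x -> S i x = Some (set_val (h i) x) /\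
                              T i (g x) = Some (g (set_val (h i) x))) ->
  embeds str G S T.
Proof.
move=> Gg STg; exists (total_map g); split.
- by move=> x y z [<-] [/esym]; exact: group_inj.
- by exists g => // x y [].
- by [].
- by [].
- by move=> i x /STg[-> /= ->].
Qed.

Lemma universalP Phi :
  universal str Phi <-> forall F h, conj_agree F h Phi.
Proof.
split=> [PhiU F h|PhiF S /KGn_extend[F [h hS]]].
  have [g Gg gP] := embeds_restrict (PhiU _ (KGn_restrict F h)).
  by exists g => // i x /(gP i)[].
have [g Gg gP] := PhiF F h.
apply: (@embeds_total_map g h) => // i x /hS[Fx ->]; split=> //.
by rewrite /total_map (conj_agree_generated Gg gP).
Qed.

Lemma universal_JEP Phi : universal str Phi -> JEP str G n.
Proof.
move=> /universalP PhiF S T /KGn_extend[F [h hS]] /KGn_extend[F' [k kT]].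
have [g Gg gP] := PhiF F h; have [g' Gg' g'P] := PhiF F' k.
(* The images under [g] and [g'] of the two generating lists together generate a substructure large
   enough to receive both embeddings. *)
exists (fun i => restrict_map (generated (map g F ++ map g' F'))
                              (set_val (Phi i))).
split; first exact: KGn_restrict.
- apply: (@embeds_total_map g h) => // i x /hS[Fx ->]; split=> //.
  rewrite restrict_mapE ?(conj_agree_generated Gg gP) //.
  apply: (@generated_sub (map g F)); first by move=> y; rewrite mem_cat => ->.
  exact: generated_map.
- apply: (@embeds_total_map g' k) => // i x /kT[Fx ->]; split=> //.
  rewrite restrict_mapE ?(conj_agree_generated Gg' g'P) //.
  apply: (@generated_sub (map g' F')).
    by move=> y; rewrite mem_cat => ->; rewrite orbT.
  exact: generated_map.
Qed.

(** Joint embedding yields a tuple of partial maps; any extension of it to a tuple in $G^n$ serves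
    as [Phi]. *)
Lemma JEP_conj_agree F h k : JEP str G n ->
  exists2 Phi, conj_agree F h Phi & conj_agree F k Phi.
Proof.
move=> J; have [U [KU]] := J _ _ (KGn_restrict F h) (KGn_restrict F k).
have /choice[u uP] i : exists u : selfmap M,
    G u /\ forall x y, U i x = Some y -> u x = y.
  by have [_ _ _ [u]] := KU i; exists u.
have [|Phi PhiE] := @lift_group u; first by move=> i; case: (uP i).
move=> /embeds_restrict[s Gs sP] /embeds_restrict[t Gt tP]; exists Phi.
- by exists s => // i x /(sP i); rewrite PhiE; exact: (uP i).2.
- by exists t => // i x /(tP i); rewrite PhiE; exact: (uP i).2.
Qed.

Lemma conj_agree_conjugate F h Phi : conj_agree F h Phi ->
  exists2 Psi, diagonal_class Phi Psi &
    forall i x, x \in F -> set_val (Psi i) x = set_val (h i) x.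
Proof.
move=> [g Gg gP]; have [_ _ GM /(_ _ Gg)[g' Gg' [gK g'K]]] := hG.
have [|Psi PsiE] := @lift_group (fun i => g' \o set_val (Phi i) \o g).
  by move=> i; apply: (GM _ _ _ Gg); exact: GM.
exists Psi => [|i x Fx]; first by exists g, g'; split.
by rewrite PsiE /= gP.
Qed.

Lemma conjugate_conj_agree F h Phi Psi : diagonal_class Phi Psi ->
  conj_agree F h Psi -> conj_agree F h Phi.
Proof.
move=> [g [g' [Gg Gg' [gK g'K] PsiE]]] [t Gt tP].
have [_ _ GM _] := hG; exists (g \o t); first exact: GM.
by move=> i x Fx /=; rewrite -(tP i x Fx) PsiE /= g'K.
Qed.

Lemma diagonal_class_sym Phi Psi :
  diagonal_class Phi Psi -> diagonal_class Psi Phi.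
Proof.
move=> [g [g' [Gg Gg' [gK g'K] PsiE]]]; exists g', g; split=> // i.
by apply: funext => x; rewrite PsiE /= !g'K.
Qed.

(** * Neighbourhoods in $G$ and $G^n$: agreement on a finite set *)

Lemma nbhs_groupP (g : set_type G) (A : set (set_type G)) :
  nbhs g A <-> exists F, [set g' : set_type G |
    forall x, x \in F -> set_val g' x = set_val g x] `<=` A.
Proof.
split=> [[_ [[B oB <-] Bg] BA]|[F FA]].
  have /nbhs_ptwsP[F [V gV VB]] : nbhs (set_val g) B by exact: open_nbhs_nbhs.
  exists F => g' g'g; apply: BA; apply: VB => x Fx; rewrite g'g //.
  exact: nbhs_singleton.
apply: filterS FA _.
apply: (@initial_continuous _ _ set_val g [set f : selfmap M |
  forall x, x \in F -> f x = set_val g x]).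
apply/nbhs_ptwsP; exists F, (fun x => [set set_val g x : M]); last by [].
by move=> x.
Qed.

Lemma nbhs_group_powerP Phi (A : set {ptws 'I_n -> set_type G}) :
  nbhs (Phi : {ptws 'I_n -> set_type G}) A <->
  exists F, [set Psi | forall i x, x \in F ->
    set_val (Psi i) x = set_val (Phi i) x] `<=` A.
Proof.
split=> [/nbhs_ptwsP[s [V PhiV VA]]|[F FA]].
  have /choice[F FP] i := (nbhs_groupP _ _).1 (PhiV i).
  exists (flatten [seq F i | i <- enum 'I_n]) => Psi PsiF.
  apply: VA => i _; apply: FP => x Fx; apply: PsiF.
  by apply/flattenP; exists (F i) => //; apply: map_f; rewrite mem_enum.
apply/nbhs_ptwsP; exists (enum 'I_n), (fun i => [set g' : set_type G |
    forall x, x \in F -> set_val g' x = set_val (Phi i) x]).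
  by move=> i; apply/nbhs_groupP; exists F.
by move=> Psi PsiF; apply: FA => i; apply: PsiF; rewrite mem_enum.
Qed.

(** * The generic tuple *)

Lemma open_conj_agree F h :
  open (conj_agree F h : set {ptws 'I_n -> set_type G}).
Proof.
(* For a fixed [g] the condition involves [Phi] only at the finitely many points of [map g F]. *)
rewrite openE => Phi [g Gg gP]; apply/nbhs_group_powerP; exists (map g F).
move=> Psi PsiP; exists g => // i x Fx.
by rewrite PsiP ?gP //; exact: map_f.
Qed.

(** The JEP gives one [Phi] with conjugates agreeing with [h] and with [Psi]. The conjugate agreeing
    with [Psi] on [F'] lies in [O], and the condition for [h] is invariant under conjugation. *)
Lemma dense_conj_agree F h : JEP str G n ->
  dense (conj_agree F h : set {ptws 'I_n -> set_type G}).
Proof.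
move=> J O [Psi OPsi] oO.
have [F' F'O] := (nbhs_group_powerP _ _).1 (open_nbhs_nbhs (conj oO OPsi)).
have [Phi [s Gs sP] /conj_agree_conjugate[Phi' Phi'C Phi'F]] :=
  JEP_conj_agree (F ++ F') h Psi J.
exists Phi'; split.
  by apply: F'O => i x Fx; rewrite Phi'F // mem_cat Fx orbT.
apply: (conjugate_conj_agree (diagonal_class_sym Phi'C)); exists s => // i x Fx.
by apply: sP; rewrite mem_cat Fx.
Qed.

Lemma JEP_universal (R : realType) : polish R (set_type G) ->
  JEP str G n -> exists Phi, universal str Phi.
Proof.
move=> Gpolish J.
(* [conj_agree F h] depends only on the restrictions of the [h i] to [F], so
   only countably many such sets have to be intersected. *)
pose restricts (c : seq M * {ffun 'I_n -> seq M}) h :=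
  forall i, map (set_val (h i)) c.1 = c.2 i.
have /choice[U UP] c :
    exists U : set {ptws 'I_n -> set_type G}, [/\ open U, dense U &
      forall h, restricts c h -> U `<=` conj_agree c.1 h].
  have [[h0 h0c]|ch] := pselect (exists h, restricts c h); last first.
    (* Codes that no tuple realises get the whole space. *)
    exists setT; split; [exact: openT | by move=> V V0 _; rewrite setIT|].
    by move=> h hc; case: ch; exists h.
  exists (conj_agree c.1 h0).
  split; [exact: open_conj_agree | exact: dense_conj_agree |].
  move=> h hc Phi [g Gg gP]; exists g => // i x cx.
  by rewrite gP //; congr g; move: x cx; apply/eq_in_map; rewrite h0c hc.
have [| | |Phi PhiU] := @polish_power_baire R (set_type G) 'I_n _ U Gpolish.
- have [_ G1 _ _] := hG.
  by have [|Phi _] := @lift_group (fun=> id); [|exists Phi].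
- by move=> c; have [] := UP c.
- by move=> c; have [] := UP c.
exists Phi; apply/universalP => F h.
have [_ _ /(_ h)] := UP (F, [ffun i => map (set_val (h i)) F]); apply => //.
by move=> i; rewrite ffunE.
Qed.

(** The tuples agreeing with [h] on [F] form basic open sets, and such a set meets the class of
    [Phi] exactly when [conj_agree F h Phi] holds. *)
Lemma dense_diagonal_classP Phi :
  dense (diagonal_class Phi) <-> forall F h, conj_agree F h Phi.
Proof.
split=> [Phid F h|PhiF O [Psi OPsi] oO].
  have [Psi [PsiF]] : [set Psi : {ptws 'I_n -> set_type G} | forall i x,
    x \in F -> set_val (Psi i) x = set_val (h i) x] `&` diagonal_class Phi !=set0.
    apply: Phid; first by exists h.
    rewrite openE => Psi PsiF; apply/nbhs_group_powerP; exists F => Psi' Psi'F.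
    by move=> i x Fx; rewrite Psi'F // PsiF.
  move=> /conjugate_conj_agree; apply; have [_ G1 _ _] := hG.
  by exists id.
have [F FO] := (nbhs_group_powerP _ _).1 (open_nbhs_nbhs (conj oO OPsi)).
have [Psi' Psi'C Psi'F] := conj_agree_conjugate (PhiF F Psi).
by exists Psi'; split=> //; exact: FO.
Qed.

End Group.

Theorem theorem3p11 (R : realType) (L : signature) (M : countType)
    (str : structure L M) (G : set (selfmap M)) (n : nat)
    (hG : permutation_group G)
    (hGstr : forall g, G g -> respects_operations str g)
    (hpolish : polish R (set_type G))
    (hn : (1 <= n)%N) :
  (JEP str G n <-> exists Phi : 'I_n -> set_type G, universal str Phi) /\
  ((exists Phi : 'I_n -> set_type G, universal str Phi) <->
   has_dense_diagonal_class G n).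
Proof.
split; split.
- exact: JEP_universal hpolish.
- by move=> [Phi]; exact: universal_JEP.
- move=> [Phi /(universalP hG hGstr) PhiF]; exists Phi.
  exact/(dense_diagonal_classP hG).
- move=> [Phi /(dense_diagonal_classP hG) PhiF]; exists Phi.
  exact/(universalP hG hGstr).
Qed.
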